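(* Let $\delta>0$, $d\ge1$, and suppose we are given a convex set $K\subset\mathbb{R}^d$ and a function $f:K\cap\delta\mathbb{Z}^d\to\mathbb{R}$. Let the one-dimensional weights $\{\alpha^k_{k+i}:\mathbb{R}\to\mathbb{R}:\ k\in\mathbb{Z},\ i=0,1,2,3,4\}$ be as defined in the context. With $i=(i_1,\dots,i_d)\in\mathbb{Z}^d$, define $$Af(x)=\sum_{i_d=0}^{4}\alpha^{k_d(x)}_{k_d(x)+i_d}(x_d)\cdots\sum_{i_1=0}^{4}\alpha^{k_1(x)}_{k_1(x)+i_1}(x_1)\,f(\delta(k(x)+i))=\sum_{i_1,\dots,i_d=0}^{4}\Big(\prod_{j=1}^d\alpha^{k_j(x)}_{k_j(x)+i_j}(x_j)\Big)f(\delta(k(x)+i)),\qquad x\in\mathrm{Conv}(K_4),$$ where $k(x)\in\mathbb{Z}^d$ is defined by $k_i(x)=\lfloor x_i/\delta\rfloor$, and $$K_4=\{x\in K\cap\delta\mathbb{Z}^d:\ \delta(k(x)+i)\in K\cap\delta\mathbb{Z}^d\ \text{ for all } 0\le i\le 4e\},$$ with $e=(1,\dots,1)\in\mathbb{R}^d$, $i\in\mathbb{Z}^d$, and inequalities between vectors understood componentwise. Then $Af\in C^3(\mathrm{Conv}(K_4))$ and $Af$ is infinitely differentiable almost everywhere on $\mathrm{Conv}(K_4)$. Also, $$Af(\delta k)=f(\delta k),\qquad \delta k\in K_4,$$ and there exists a constant $C>0$ independent of $f$, $x$ and $\delta$ such that $$\Big|\frac{\partial^a}{\partial x^a}Af(x)\Big|\le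 C\delta^{-\|a\|_1}\max_{\substack{0\le i_j\le 4-a_j\\ j=1,\dots,d}}\big|\Delta_1^{a_1}\cdots\Delta_d^{a_d}f(\delta(k(x)+i))\big|,\qquad x\in\mathrm{Conv}(K_4),$$ for $0\le\|a\|_1\le3$ ($a\in\mathbb{N}^d$), and this inequality also holds when $\|a\|_1=4$ for almost all $x\in\mathrm{Conv}(K_4)$.
   Context: $\mathbb{N}=\{0,1,2,\dots\}$, $\delta\mathbb{Z}^d=\{\delta k:k\in\mathbb{Z}^d\}$, $\mathrm{Conv}(B)$ is the convex hull of $B$, $C^3(B)$ is the set of three times continuously differentiable functions on $B$, and $\|a\|_1=\sum_j|a_j|$. For $a\in\mathbb{N}^d$, $\frac{\partial^a}{\partial x^a}=\frac{\partial^{a_1}}{\partial x_1^{a_1}}\cdots\frac{\partial^{a_d}}{\partial x_d^{a_d}}$ (with $a=0$ giving the function itself). With $e^{(j)}$ the $j$th unit vector, $\Delta_jf(\delta k)=f(\delta(k+e^{(j)}))-f(\delta k)$, $\Delta_j^0f=f$, and $\Delta_j^{m+1}f(\delta k)=\Delta_j^mf(\delta(k+e^{(j)}))-\Delta_j^mf(\delta k)$. ''Almost everywhere/almost all'' refers to Lebesgue measure. Definition of the one-dimensional weights $\alpha^k_{k+i}:\mathbb{R}\to\mathbb{R}$ ($k\in\mathbb{Z}$, $i=0,\dots,4$). For $g:\delta\mathbb{Z}\to\mathbb{R}$, with the one-dimensional forward difference $\Delta g(\delta k)=g(\delta(k+1))-g(\delta k)$ and its powers, and $t=(x-\delta k)/\delta$,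 put $$P_k(x)=g(\delta k)+t\big(\Delta-\tfrac12\Delta^2+\tfrac13\Delta^3\big)g(\delta k)+\tfrac12t^2\big(\Delta^2-\Delta^3\big)g(\delta k)+\tfrac16t^3\Delta^3g(\delta k)+\big(-\tfrac{23}{3}t^4+\tfrac{41}{2}t^5-\tfrac{55}{3}t^6+\tfrac{11}{2}t^7\big)\Delta^4g(\delta k).$$ Expanding the differences, $P_k(x)=\sum_{i=0}^4\alpha^k_{k+i}(x)g(\delta(k+i))$, and $\alpha^k_{k+i}(x)$ is the coefficient of $g(\delta(k+i))$; it is a polynomial in $t$ not depending on $g$. *)

(* Defs.v *)
From HB Require Import structures.
From mathcomp Require Import all_boot all_order all_algebra.
From mathcomp Require Import all_classical all_reals all_analysis.
From mathcomp Require Import ring.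

Set Implicit Arguments.
Unset Strict Implicit.
Unset Printing Implicit Defensive.

Import Order.TTheory GRing.Theory Num.Theory.
Import numFieldNormedType.Exports.

Local Open Scope classical_set_scope.
Local Open Scope ring_scope.

Section OneDim.
Variable R : realType.
Implicit Types (delta x : R) (k m : int) (g : int -> R).

(* A function on the grid delta Z is given by its values g m at delta * m. *)
Definition fdiff1 g : int -> R := fun k => g (k + 1) - g k.

Definition interp1 delta k g x : R :=
  let D n := iter n fdiff1 g k in
  let t := (x - delta * k%:~R) / delta in
  g k + t * (D 1 - 2^-1 * D 2 + 3^-1 * D 3)
  + 2^-1 * t ^+ 2 * (D 2 - D 3)
  + 6^-1 * t ^+ 3 * D 3
  + (- (23 / 3) * t ^+ 4 + 41 / 2 * t ^+ 5 - 55 / 3 * t ^+ 6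
     + 11 / 2 * t ^+ 7) * D 4.

(* alpha^k_m(x), the coefficient of g m in interp1 delta k g x: as interp1 is
   linear in g, this is its value at the indicator function of m; see
   interp1E. *)
Definition alpha delta k m x : R :=
  interp1 delta k (fun n => (n == m)%:R) x.

Lemma interp1E delta k g x :
  interp1 delta k g x = \sum_(i < 5) alpha delta k (k + i%:Z) x * g (k + i%:Z).
Proof.
have e m n : ((k + m == k + n) = (m == n))%R by rewrite (inj_eq (addrI k)).
have e0 n : ((k == k + n) = (0 == n))%R by rewrite -{1}[k]addr0 e.
have k2 : k + 1 + 1 = k + 2%:Z by rewrite -addrA.
have k3 : k + 2%:Z + 1 = k + 3%:Z by rewrite -addrA.
have k4 : k + 3%:Z + 1 = k + 4%:Z by rewrite -addrA.
rewrite !big_ord_recr big_ord0 /alpha /interp1 /= /fdiff1.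
rewrite !k2 !k3 !k4 !e !e0 !addr0 /=.
set t := (x - _) / _.
by field.
Qed.

End OneDim.

Section MultiDim.
Variables (R : realType) (d : nat).
Implicit Types (delta : R) (x : 'rV[R]_d) (k : 'rV[int]_d).
Implicit Types (K B U : set 'rV[R]_d) (f g : 'rV[R]_d -> R).
Implicit Types (u : 'rV[int]_d -> R) (a : 'I_d -> nat) (j : 'I_d).

Definition lat delta k : 'rV[R]_d := delta *: map_mx intr k.

Definition lattice delta : set 'rV[R]_d := range (lat delta).

Definition cell delta x : 'rV[int]_d := \row_j Num.floor (x 0 j / delta).

(* The integer vectors i with 0 <= i <= 4e. *)
Definition offset (i : {ffun 'I_d -> 'I_5}) : 'rV[int]_d := \row_j (i j)%:Z.

Definition K4 delta K : set 'rV[R]_d :=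
  [set x | (K `&` lattice delta) x /\
     forall i, (K `&` lattice delta) (lat delta (cell delta x + offset i))].

Definition conv_hull B : set 'rV[R]_d :=
  smallest (fun A => convex_set (A : set (convex_lmodType 'rV[R]_d))) B.

(* f stands for a function on K `&` lattice delta: it is a total function whose
   values off that set are arbitrary. For x in conv_hull (K4 delta K) with d > 1
   a point lat delta (cell delta x + offset i) may fall outside K. *)
Definition Aop delta f x : R :=
  \sum_(i : {ffun 'I_d -> 'I_5})
    (\prod_j alpha delta (cell delta x 0 j) (cell delta x 0 j + (i j)%:Z)
                   (x 0 j))
    * f (lat delta (cell delta x + offset i)).

Definition mnorm1 a : nat := (\sum_j a j)%N.

Definition fdiff j u : 'rV[int]_d -> R :=
  fun k => u (k + delta_mx 0 j) - u k.

(* Delta_1^{a_1} ... Delta_d^{a_d} u *)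
Definition mfdiff a u : 'rV[int]_d -> R :=
  foldr (fun j => iter (a j) (fdiff j)) u (enum 'I_d).

Definition partial j g : 'rV[R]_d -> R := 'D_(delta_mx 0 j) g.

Definition mpartial a g : 'rV[R]_d -> R :=
  foldr (fun j => iter (a j) (partial j)) g (enum 'I_d).

(* n times continuously differentiable at the points of an open set U *)
Fixpoint Cn_open (n : nat) U g : Prop :=
  (forall x, U x -> {for x, continuous g}) /\
  if n is n'.+1 then
    forall j, (forall x, U x -> derivable g x (delta_mx 0 j)) /\
              Cn_open n' U (partial j g)
  else True.

(* On a set B that need not be open: C^n on an open neighbourhood of B, so that
   the partial derivatives at the boundary points of B are the usual ones. *)
Definition Cn (n : nat) B g : Prop :=
  exists U, [/\ open U, B `<=` U & Cn_open n U g].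

Definition smooth_at g x : Prop :=
  exists U, [/\ open U, U x & forall n, Cn_open n U g].

Definition box (b : 'rV[R]_d * 'rV[R]_d) : set 'rV[R]_d :=
  [set x | forall j, b.1 0 j <= x 0 j <= b.2 0 j].

Definition box_vol (b : 'rV[R]_d * 'rV[R]_d) : R :=
  \prod_j Num.max 0 (b.2 0 j - b.1 0 j).

(* d-dimensional Lebesgue outer measure; the Lebesgue null sets are the sets of
   outer measure 0. *)
Definition lebesgue_outer B : \bar R :=
  ereal_inf [set (\sum_(0 <= n <oo) (box_vol (b n))%:E)%E |
              b in [set b : nat -> 'rV[R]_d * 'rV[R]_d |
                     B `<=` \bigcup_n box (b n)]].

Definition ae_on B (P : 'rV[R]_d -> Prop) : Prop :=
  lebesgue_outer (B `&` [set x | ~ P x]) = 0%E.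

Definition derivative_bound (C : R) delta f a x : Prop :=
  `|mpartial a (Aop delta f) x| <=
  C * delta ^- mnorm1 a *
  \big[Num.max/0]_(i : {ffun 'I_d -> 'I_5} | [forall j, (i j <= 4 - a j)%N])
     `|mfdiff a (fun k => f (lat delta k)) (cell delta x + offset i)|.

End MultiDim.

(* Main.v *)
Require Import Defs.
From mathcomp Require Import all_boot all_order all_algebra.
From mathcomp Require Import all_classical all_reals all_analysis.
From mathcomp Require Import ring lra zify.

(** [Aop delta f] is a tensor product of one-dimensional constructions. Let
    [dalpha delta 0 m] be the function on the line that gives, at each [x],
    the weight of the grid index [m] in the interpolant of the cell of [x]. On
    every cell it is a polynomial, and the coefficients of the interpolant are
    such that the polynomials of two neighbouring cells agree to third order at
    the common grid point ([dinterp_match]). Hence it is of class C^3, and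
    smooth off the grid ([is_derive_dalpha], [continuous_dalpha]).

    Near any point [Aop delta f] is a fixed finite linear combination of
    products of such functions of the separate coordinates ([Ader_near]).
    Therefore its partial derivative of order [a] is [Ader delta u a], obtained
    by replacing each weight by its derivative of order [a_j], wherever in each
    coordinate [a_j <= 3] or the point is off the grid ([mpartial_Ader]). The
    values of [f] on the lattice enter arbitrarily, so that the regularity
    holds on the whole space and thus on any convex hull. The exceptional
    points lie on the countably many hyperplanes [x_j = delta m], which are
    null sets ([ae_on_offgrid]).

    For the estimate, the [a]th derivative of the one-dimensional interpolant
    involves only differences of order at least [a], as the multiplier of the
    [n]th difference has degree [n] for [n <= 3]. It is therefore [delta ^- a]
    times a combination of the values of the [a]th difference at
    [k, ..., k + 4 - a], with coefficients polynomial in the cell coordinate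
    ([dalpha_stencil]). Taking products over the coordinates,
    [Ader delta u a x] is [delta ^- mnorm1 a] times a combination of the mixed
    differences of order [a] at the points over which the maximum is taken
    ([Ader_stencil]). The coefficients are bounded because the cell coordinates
    lie in [0, 1].

    The passage from one to several dimensions always has the same form: grid
    values are expanded in products of one-dimensional indicators
    ([box_expansion]), and a sum of products is a product of sums. *)

Set Implicit Arguments.
Unset Strict Implicit.
Unset Printing Implicit Defensive.
Import Order.TTheory GRing.Theory Num.Theory.
Import numFieldNormedType.Exports.
Local Open Scope classical_set_scope.
Local Open Scope ring_scope.

(** * Finite differences on the integer lattice *)

Section FiniteDifferences.
Variables (R : realType) (d : nat).
Implicit Types (g : int -> R) (k z s : 'rV[int]_d) (u v : 'rV[int]_d -> R).
Implicit Types (j : 'I_d) (r : seq 'I_d) (a : 'I_d -> nat).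

Definition kron (m : int) : int -> R := fun n => (n == m)%:R.

Definition tprod (g : 'I_d -> int -> R) : 'rV[int]_d -> R :=
  fun z => \prod_j g j (z 0 j).

Lemma tprod_kron z s : tprod (fun j => kron (s 0 j)) z = (z == s)%:R.
Proof.
rewrite /tprod /kron; case: (eqVneq z s) => [->|zs].
  by rewrite big1 // => j _; rewrite eqxx.
have /rowP/eqfunP : z <> s by apply/eqP.
rewrite negb_forall => /existsP [j zj]; rewrite (bigD1 j)//=.
by rewrite (negbTE zj) mul0r.
Qed.

(** Reduces identities that are linear in a grid function to products of
    one-dimensional indicator functions. *)
Lemma box_expansion (N : nat) (b z : 'rV[int]_d) u :
  (forall j, b 0 j <= z 0 j < b 0 j + N%:Z) ->
  u z = \sum_(s : {ffun 'I_d -> 'I_N})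
    u (b + \row_j (s j)%:Z) * tprod (fun j => kron (b 0 j + (s j)%:Z)) z.
Proof.
move=> zb.
have lt_zb j : (`|(z 0%R j - b 0%R j)%R| < N)%N.
  by have := zb j; lia.
pose s0 := [ffun j => Ordinal (lt_zb j)].
have zE : z = b + \row_j (s0 j)%:Z.
  by apply/rowP => j; rewrite !mxE ffunE/=; have := zb j; lia.
rewrite (bigD1 s0)//= -zE.
have tE (s : {ffun 'I_d -> 'I_N}) :
    tprod (fun j => kron (b 0 j + (s j)%:Z)) z = (s == s0)%:R.
  have -> : tprod (fun j => kron (b 0 j + (s j)%:Z)) z =
            tprod (fun j => kron ((b + \row_j (s j)%:Z) 0 j)) z.
    by apply: eq_bigr => j _; rewrite !mxE.
  rewrite tprod_kron {1}zE (inj_eq (addrI b)); congr (nat_of_bool _)%:R.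
  apply/eqP/eqP => [/rowP e|->//]; apply/ffunP => j; apply/val_inj/eqP.
  by have := e j; rewrite !mxE => /eqP; rewrite eqz_nat eq_sym.
rewrite tE eqxx mulr1 big1 ?addr0// => s /negbTE ns.
by rewrite tE ns mulr0.
Qed.

Lemma fdiff_tprod j (g : 'I_d -> int -> R) :
  fdiff j (tprod g) = tprod (fun i => if i == j then fdiff1 (g i) else g i).
Proof.
apply/funext => z; rewrite /fdiff /tprod (bigD1 j)//= (bigD1 j (P:=xpredT))//=.
rewrite [RHS](bigD1 j)//= eqxx !mxE !eqxx /fdiff1 mulrBl; congr (_ * _ - _ * _).
  by apply: eq_bigr => i ij; rewrite !mxE (negbTE ij) addr0.
by apply: eq_bigr => i ij; rewrite (negbTE ij).
Qed.

Lemma iter_fdiff_tprod n j (g : 'I_d -> int -> R) :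
  iter n (fdiff j) (tprod g) =
  tprod (fun i => if i == j then iter n (@fdiff1 R) (g i) else g i).
Proof.
elim: n => [|n /= ->].
  by apply/funext => z; apply: eq_bigr => i _; case: eqP.
by rewrite fdiff_tprod; apply/funext => z; apply: eq_bigr => i _; case: eqP.
Qed.

(** A mixed difference acts on each factor of a product separately, which is
    what reduces the estimate to dimension one. *)
Lemma mfdiff_tprod a (g : 'I_d -> int -> R) :
  mfdiff a (tprod g) = tprod (fun j => iter (a j) (@fdiff1 R) (g j)).
Proof.
suff H r : uniq r ->
    foldr (fun j => iter (a j) (fdiff j)) (tprod g) r =
    tprod (fun j => if j \in r then iter (a j) (@fdiff1 R) (g j) else g j).
  rewrite /mfdiff H ?enum_uniq//; apply/funext => z.
  by apply: eq_bigr => j _; rewrite mem_enum.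
elim: r => [_|j r IH /= /andP[jr ur]]; first exact/funext.
rewrite IH// iter_fdiff_tprod; apply/funext => z; apply: eq_bigr => i _.
by rewrite in_cons; case: eqP => [->|//]; rewrite (negbTE jr).
Qed.

Lemma mfdiff_sum (I : finType) a (c : I -> R) (w : I -> 'rV[int]_d -> R) :
  mfdiff a (fun z => \sum_i c i * w i z) =
  fun z => \sum_i c i * mfdiff a (w i) z.
Proof.
have D j (w' : I -> 'rV[int]_d -> R) : fdiff j (fun z => \sum_i c i * w' i z) =
    fun z => \sum_i c i * fdiff j (w' i) z.
  apply/funext => z; rewrite /fdiff -sumrB.
  by apply: eq_bigr => i _; rewrite mulrBr.
rewrite /mfdiff; elim: (enum _) => [//|j r /= ->].
by elim: (a j) => [//|n /= ->].
Qed.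

Lemma iter_fdiff_local n j u v z :
  (forall i, (i <= n)%N -> u (z + delta_mx 0 j *+ i) = v (z + delta_mx 0 j *+ i)) ->
  iter n (fdiff j) u z = iter n (fdiff j) v z.
Proof.
elim: n z => [|n IH] z uv /=; first by have := uv 0%N erefl; rewrite mulr0n addr0.
rewrite /fdiff; congr (_ - _); apply: IH => i iN.
  by rewrite -addrA -mulrS; apply: uv.
by apply: uv; rewrite leqW.
Qed.

(** Confines the estimate to the stencil: every single difference in direction
    [j] looks one step ahead along [j]. *)
Lemma mfdiff_local a u v z :
  (forall s : 'I_d -> nat, (forall j, s j <= a j)%N ->
     u (z + \row_j (s j)%:Z) = v (z + \row_j (s j)%:Z)) ->
  mfdiff a u z = mfdiff a v z.
Proof.
move=> uv.
suff H r : uniq r -> forall z : 'rV[int]_d,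
    (forall s : 'I_d -> nat, (forall j, s j <= if j \in r then a j else 0)%N ->
     u (z + \row_j (s j)%:Z) = v (z + \row_j (s j)%:Z)) ->
    foldr (fun j => iter (a j) (fdiff j)) u r z =
    foldr (fun j => iter (a j) (fdiff j)) v r z.
  apply: H; first exact: enum_uniq.
  by move=> s sa; apply: uv => j; have := sa j; rewrite mem_enum.
elim: r {uv z} => [_ z uv|j r IH /= /andP[jr ur] z uv].
  have := uv (fun=> 0%N) (fun=> leqnn 0).
  rewrite (_ : \row__ _ = 0) ?addr0//.
  by apply/rowP => i; rewrite !mxE.
apply: iter_fdiff_local => n na; apply: IH => // s sa.
(* Along [j] the displacement is [n] alone: [s] vanishes there, as [j] does
   not occur in [r]. *)
have -> : z + delta_mx 0 j *+ n + \row_j0 (s j0)%:Z =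
          z + \row_i (s i + (i == j) * n)%N%:Z.
  apply/rowP => i; rewrite !mxE mulmxnE !mxE eqxx/= -!addrA; congr (_ + _).
  by case: eqP => _; rewrite /= ?mul1n ?mul0n ?mul0rn; lia.
apply: uv => i; rewrite in_cons; have := sa i.
case: eqP => [->|_] /=; last by rewrite addn0.
by rewrite (negbTE jr) leqn0 => /eqP ->; rewrite mul1n.
Qed.

End FiniteDifferences.

(** * Piecewise functions and the one-dimensional weights *)

Section Gluing.
Variables (R : realType).

(** Treats a function given by different formulas on the two sides of a point
    without distinguishing the sides, hence also at points where the two
    formulas coincide. *)
Lemma cvg_glue (T : Type) (F : set_system T) (f g h : T -> R)
    (l : R) : Filter F ->
  (\forall y \near F, f y = g y \/ f y = h y) ->
  g y @[y --> F] --> l -> h y @[y --> F] --> l -> f y @[y --> F] --> l.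
Proof.
move=> FF fgh /cvgrPdist_lt gl /cvgrPdist_lt hl; apply/cvgrPdist_lt => e e0.
near=> y.
have [->|->] : f y = g y \/ f y = h y by near: y.
- by near: y; exact: gl.
- by near: y; exact: hl.
Unshelve. all: by end_near. Qed.

Lemma is_derive_glue (f g h : R -> R) (x l : R) :
  (\forall y \near x, f y = g y \/ f y = h y) ->
  g x = f x -> h x = f x ->
  is_derive x 1 g l -> is_derive x 1 h l -> is_derive x 1 f l.
Proof.
move=> fgh gx hx [dg gl] [dh hl].
have cf : e^-1 *: (f (e *: 1 + x) - f x) @[e --> 0^'] --> l.
  refine (cvg_glue (g := fun e : R => e^-1 *: (g (e *: 1 + x) - g x))
    (h := fun e : R => e^-1 *: (h (e *: 1 + x) - h x)) _ _ _ _).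
  - have cx : (fun e : R => e *: (1 : R) + x) @ 0 --> x.
      rewrite -[X in _ --> X]add0r; apply: cvgD; last exact: cvg_cst.
      by rewrite -[X in _ --> X](scale0r (1 : R)); exact: scalel_continuous.
    have fgh0 : \forall e \near (0 : R), f (e *: 1 + x) = g (e *: 1 + x) \/
                               f (e *: 1 + x) = h (e *: 1 + x) := cx _ fgh.
    rewrite gx hx; near=> e.
    have [->|->] : f (e *: 1 + x) = g (e *: 1 + x) \/ f (e *: 1 + x) = h (e *: 1 + x).
    + by near: e; apply: cvg_within; exact: fgh0.
    + by left.
    + by right.
  - by rewrite -gl; exact: dg.
  - by rewrite -hl; exact: dh.
by split; [apply/cvg_ex; exists l | apply/cvg_lim].
Unshelve. all: by end_near. Qed.

End Gluing.

Section OneDim.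
Variable R : realType.
Implicit Types (delta x y t : R) (k m : int) (g : int -> R).

(** The multiplier of the [n]th difference in [interp1], as a polynomial in
    the cell coordinate. Those of index at most 3 are the binomial
    polynomials of Newton's formula; index 4 is the correction that makes
    neighbouring cells agree. *)
Definition newton (n : nat) : {poly R} :=
  nth 0 [:: 1; 'X; 2^-1 *: ('X^2 - 'X);
            6^-1 *: 'X^3 - 2^-1 *: 'X^2 + 3^-1 *: 'X;
            (11 / 2) *: 'X^7 - (55 / 3) *: 'X^6 + (41 / 2) *: 'X^5
            - (23 / 3) *: 'X^4] n.

(** The [a]th derivative of [interp1 delta k g]. *)
Definition dinterp a delta k g x : R :=
  delta ^- a * \sum_(n < 5) (newton n)^`(a).[(x - delta * k%:~R) / delta]
                 * iter n (@fdiff1 R) g k.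

Lemma interp1_dinterp delta k g x : interp1 delta k g x = dinterp 0 delta k g x.
Proof.
rewrite /dinterp /interp1; move: (_ / delta) => t.
rewrite expr0 invr1 !big_ord_recr big_ord0 /newton /=.
rewrite !(hornerZ, hornerD, hornerN, hornerXn, hornerX, hornerC).
by field.
Qed.

(** The reason for the coefficients of the quartic-and-higher term: the cubic
    Newton interpolants at [k, ..., k + 3] and at [k + 1, ..., k + 4] differ by
    [(t - 1)(t - 2)(t - 3) / 6] times the fourth difference, and [newton 4]
    agrees to third order with this polynomial at [t = 1] and with zero
    at [t = 0]. *)
Lemma dinterp_match a delta k g : delta != 0 -> (a <= 3)%N ->
  dinterp a delta k g (delta * (k + 1)%:~R) =
  dinterp a delta (k + 1) g (delta * (k + 1)%:~R).
Proof.
move=> d0 a3; rewrite /dinterp subrr mul0r.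
have -> : (delta * (k + 1)%:~R - delta * k%:~R) / delta = 1.
  by rewrite -mulrBr -intrB addrAC subrr add0r mulr1 divff.
congr (_ * _); rewrite !big_ord_recr !big_ord0 /newton /fdiff1.
move: a a3 => [|[|[|[|//]]]] _ /=.
all: rewrite ?derivnS ?derivn0.
all: rewrite ?(derivD, derivN, derivZ, derivMn, derivXn, derivX, derivC) /=.
all: rewrite !(hornerD, hornerN, hornerZ, hornerMn, hornerXn, hornerX, hornerC).
all: by field.
Qed.

(** Writing [dinterp] as a polynomial in [x] itself gives its derivative and
    its continuity at once. *)
Definition dinterp_poly a delta k g : {poly R} :=
  delta ^- a *: ((\sum_(n < 5) iter n (@fdiff1 R) g k *: (newton n)^`(a))
    \Po (delta^-1 *: ('X - (delta * k%:~R)%:P))).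

Lemma dinterp_polyE a delta k g : dinterp a delta k g = horner (dinterp_poly a delta k g).
Proof.
apply/funext => x; rewrite /dinterp /dinterp_poly hornerZ horner_comp.
rewrite horner_sum hornerZ hornerD hornerN hornerX hornerC [delta^-1 * _]mulrC.
congr (_ * _); apply: eq_bigr => n _.
by rewrite hornerZ; exact: mulrC.
Qed.

Lemma deriv_dinterp_poly a delta k g :
  (dinterp_poly a delta k g)^`() = dinterp_poly a.+1 delta k g.
Proof.
rewrite /dinterp_poly derivZ deriv_comp derivZ derivB derivX derivC subr0.
rewrite raddf_sum/= -scalerAr mulr1 scalerA exprSr invfM.
congr (_ *: (_ \Po _)); apply: eq_bigr => n _; by rewrite derivZ -derivnS.
Qed.

Lemma is_derive_dinterp a delta k g x :
  is_derive x 1 (dinterp a delta k g) (dinterp a.+1 delta k g x).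
Proof. by rewrite !dinterp_polyE -deriv_dinterp_poly; exact: is_derive_poly. Qed.

Lemma continuous_dinterp a delta k g : continuous (dinterp a delta k g).
Proof. by rewrite dinterp_polyE; exact: continuous_horner. Qed.

Lemma iter_fdiff1_coef n g k : (n < 5)%N ->
  iter n (@fdiff1 R) g k =
  \sum_(l < 5) (-1) ^+ (n - l) * 'C(n, l)%:R * g (k + l%:Z).
Proof.
have k2 : k + 1 + 1 = k + 2%:Z by rewrite -addrA.
have k3 : k + 2%:Z + 1 = k + 3%:Z by rewrite -addrA.
have k4 : k + 3%:Z + 1 = k + 4%:Z by rewrite -addrA.
rewrite !big_ord_recr big_ord0.
move: n => [|[|[|[|[|//]]]]] _ /=; rewrite /fdiff1/= ?(k2, k3, k4) ?addr0.
all: rewrite ?(bin0, binS, bin0n, subSS, sub0n, subn0) /=; ring.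
Qed.

(** The coefficient of [Delta^a g (k + l)] in [delta^a] times the [a]th
    derivative of the interpolating polynomial. *)
Definition stencil a l : {poly R} :=
  \sum_(n < 5 | (a <= n)%N) ((-1) ^+ (n - a - l) * 'C(n - a, l)%:R) *: (newton n)^`(a).

Lemma stencil_eq0 a l : (4 < a + l)%N -> stencil a l = 0.
Proof.
move=> al; rewrite /stencil big1// => n an.
by rewrite bin_small ?mulr0 ?scale0r//; have := ltn_ord n; lia.
Qed.

Lemma size_newton n : (n < 4)%N -> (size (newton n) <= n.+1)%N.
Proof.
have sD (p q : {poly R}) (i : nat) :
    (size p <= i)%N -> (size q <= i)%N -> (size (p + q)%R <= i)%N.
  by move=> pm qm; rewrite (leq_trans (size_polyD _ _))// geq_max pm.
have sZ (p : {poly R}) c (i : nat) : (size p <= i)%N -> (size (c *: p)%R <= i)%N.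
  by move=> pi; exact: leq_trans (size_scale_leq _ _) pi.
have sX : (size ('X : {poly R}) <= 2)%N by rewrite size_polyX.
move: n => [|[|[|[|//]]]] _ /=.
- by rewrite size_polyC leq_b1.
- exact: sX.
- by apply: (sZ); apply: (sD); rewrite ?size_polyXn// size_polyN; exact: leq_trans sX _.
- apply: (sD); last by apply: (sZ); exact: leq_trans sX _.
  by apply: (sD); rewrite ?size_polyN; apply: (sZ); rewrite size_polyXn.
Qed.

(** Newton polynomials of degree below [a] do not survive [a] derivatives, so
    only differences of order at least [a] remain, and these are combinations
    of translates of [Delta^a g]. *)
Lemma dinterp_stencil a delta k g x : (a <= 4)%N ->
  dinterp a delta k g x =
  delta ^- a * \sum_(l < 5) (stencil a l).[(x - delta * k%:~R) / delta]
                 * iter a (@fdiff1 R) g (k + l%:Z).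
Proof.
move=> a4; rewrite /dinterp; congr (_ * _); set t := _ / delta.
under [RHS]eq_bigr do rewrite /stencil horner_sum mulr_suml.
rewrite exchange_big/= [LHS](bigID (fun n : 'I_5 => (a <= n)%N))/=.
rewrite [X in _ + X]big1 ?addr0 => [|n]; last first.
  rewrite -ltnNge => na; rewrite derivn_poly0 ?horner0 ?mul0r//.
  by rewrite (leq_trans _ na)// size_newton//; exact: leq_trans na a4.
apply: eq_bigr => n an.
have -> : iter n (@fdiff1 R) g = iter (n - a) (@fdiff1 R) (iter a (@fdiff1 R) g).
  by rewrite -iterD subnK.
rewrite iter_fdiff1_coef; last first.
  exact: leq_ltn_trans (leq_subr _ _) (ltn_ord n).
by rewrite mulr_sumr; apply: eq_bigr => l _; rewrite hornerZ; ring.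
Qed.

Definition offgrid delta x := forall k, x <> delta * k%:~R.

(** The [a]th derivative of the weight with which the value at the grid index
    [m] enters the interpolant, as a function on the whole line: the grid
    index is fixed while the cell follows [x]. *)
Definition dalpha delta a m x : R :=
  dinterp a delta (Num.floor (x / delta)) (kron R m) x.

Lemma floor_cell delta k x : 0 < delta ->
  delta * k%:~R <= x < delta * (k + 1)%:~R -> Num.floor (x / delta) = k.
Proof.
move=> d0 /andP[kx xk]; apply: floor_def; apply/andP; split.
  by rewrite ler_pdivlMr// mulrC.
by rewrite ltr_pdivrMr// mulrC.
Qed.

Lemma cell_floor delta x (k := Num.floor (x / delta)) : 0 < delta ->
  delta * k%:~R <= x < delta * (k + 1)%:~R.
Proof.
move=> d0; have /andP[kx xk] := floor_itv (x / delta).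
by rewrite ![delta * _]mulrC -ler_pdivlMr// -ltr_pdivrMr// kx.
Qed.

(** [k'] is the cell on the left when [x] is a grid point; otherwise [k' = k],
    so that later arguments need not separate the two cases. *)
Lemma near_cell delta x (k := Num.floor (x / delta)) : 0 < delta ->
  exists2 k' : int, k' = k \/ (x = delta * k%:~R /\ k = k' + 1) &
    \forall y \near x, Num.floor (y / delta) = k \/ Num.floor (y / delta) = k'.
Proof.
move=> d0; have /andP[kx xk] := cell_floor x d0; rewrite -/k in kx xk.
have [xE|xnk] := eqVneq x (delta * k%:~R).
  exists (k - 1); first by right; rewrite subrK.
  have kx' : delta * (k - 1)%:~R < x.
    by rewrite xE ltr_pM2l// ltr_int; lia.
  near=> y.
  have [yk|ky] := ltP y (delta * k%:~R); [right|left]; apply: floor_cell => //.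
    by rewrite subrK yk andbT ltW//; near: y; exact: lt_nbhsr.
  by rewrite ky/=; near: y; exact: lt_nbhsl.
exists k; first by left.
have kx' : delta * k%:~R < x by rewrite lt_neqAle eq_sym xnk.
near=> y; left; apply: floor_cell => //.
rewrite ltW/=; last by near: y; exact: lt_nbhsr.
by near: y; exact: lt_nbhsl.
Unshelve. all: by end_near. Qed.

(** Where the formulas of the cells meeting at [x] have the same [a]th
    derivative. *)
Definition smooth_order delta a x := (a <= 3)%N \/ offgrid delta x.

Lemma near_dalpha delta x : 0 < delta -> exists k' : int,
  (forall m a, smooth_order delta a x ->
     dinterp a delta k' (kron R m) x = dalpha delta a m x) /\
  \forall y \near x, forall a m,
    dalpha delta a m y = dinterp a delta (Num.floor (x / delta)) (kron R m) y \/
    dalpha delta a m y = dinterp a delta k' (kron R m) y.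
Proof.
move=> d0; have [k' k'E nk] := near_cell x d0; exists k'; split.
  rewrite /dalpha => m a xa; case: k'E => [->//|[xE kE]].
  case: xa => [a3|/(_ _ xE)//].
  by rewrite kE in xE *; rewrite xE dinterp_match// gt_eqF.
by apply: filterS nk => y [e|e] a m; rewrite /dalpha e; [left|right].
Qed.

(** Both formulas valid near [x] have, by [dinterp_match], the same value and
    the same derivative at [x]. *)
Lemma is_derive_dalpha delta a m x : 0 < delta -> smooth_order delta a.+1 x ->
  is_derive x 1 (dalpha delta a m) (dalpha delta a.+1 m x).
Proof.
move=> d0 xa1; have xa : smooth_order delta a x.
  by case: xa1 => [/ltnW|]; [left|right].
have [k' [k'E nk]] := near_dalpha x d0.
apply: (is_derive_glue (g := dinterp a delta (Num.floor (x / delta)) (kron R m))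
  (h := dinterp a delta k' (kron R m))) => //.
- by apply: filterS nk => y; exact.
- exact: k'E.
- exact: is_derive_dinterp.
- by rewrite -k'E//; exact: is_derive_dinterp.
Qed.

Lemma continuous_dalpha delta a m x : 0 < delta -> smooth_order delta a x ->
  {for x, continuous (dalpha delta a m)}.
Proof.
move=> d0 xa; have [k' [k'E nk]] := near_dalpha x d0.
refine (cvg_glue (g := dinterp a delta (Num.floor (x / delta)) (kron R m))
  (h := dinterp a delta k' (kron R m)) _ _ _ _).
- by apply: filterS nk => y; exact.
- exact: continuous_dinterp.
- by rewrite -k'E//; exact: continuous_dinterp.
Qed.

Lemma dalpha0 delta m x : dalpha delta 0 m x = alpha delta (Num.floor (x / delta)) m x.
Proof. by rewrite /alpha interp1_dinterp. Qed.

Lemma dalpha_support delta a m x (k := Num.floor (x / delta)) :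
  (forall l : 'I_5, m <> k + l%:Z) -> dalpha delta a m x = 0.
Proof.
move=> mk; rewrite /dalpha /dinterp big1 ?mulr0// => n _.
rewrite iter_fdiff1_coef// big1 ?mulr0// => l _.
rewrite /kron; case: eqP => [e|_]; last by rewrite mulr0.
by case: (mk l).
Qed.

Lemma dalpha_stencil delta a m x (k := Num.floor (x / delta)) : (a <= 4)%N ->
  dalpha delta a m x =
  delta ^- a * \sum_(l < 5) (stencil a l).[(x - delta * k%:~R) / delta]
                 * iter a (@fdiff1 R) (kron R m) (k + l%:Z).
Proof. exact: dinterp_stencil. Qed.

Lemma cell_coord_itv delta x : 0 < delta ->
  0 <= (x - delta * (Num.floor (x / delta))%:~R) / delta <= 1.
Proof.
move=> d0; have /andP[kx xk] := cell_floor x d0; apply/andP; split.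
  by rewrite divr_ge0 ?subr_ge0// ltW.
by rewrite ler_pdivrMr// mul1r lerBlDl -[X in _ + X]mulr1 -mulrDr -intrD1 ltW.
Qed.

Lemma offgrid_near delta x : 0 < delta -> offgrid delta x ->
  \forall y \near x, offgrid delta y.
Proof.
move=> d0 ox; have /andP[kx xk] := cell_floor x d0.
set k := Num.floor _ in kx xk.
have kx' : delta * k%:~R < x by rewrite lt_neqAle kx andbT eq_sym; apply/eqP.
near=> y; move=> l yl.
have ky : delta * k%:~R < y by near: y; exact: lt_nbhsr.
have yk : y < delta * (k + 1)%:~R by near: y; exact: lt_nbhsl.
by move: ky yk; rewrite yl !ltr_pM2l// !ltr_int; lia.
Unshelve. all: by end_near. Qed.

Lemma horner_bound (p : {poly R}) t : 0 <= t <= 1 ->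
  `|p.[t]| <= \sum_(i < size p) `|p`_i|.
Proof.
move=> /andP[t0 t1]; rewrite horner_coef (le_trans (ler_norm_sum _ _ _))//.
apply: ler_sum => i _; rewrite normrM ler_piMr// ger0_norm ?exprn_ge0//.
exact: exprn_ile1.
Qed.

Lemma stencil_bounded : exists2 M : R, 0 < M &
  forall a l t, (a <= 4)%N -> (l <= 4)%N -> 0 <= t <= 1 -> `|(stencil a l).[t]| <= M.
Proof.
pose S (p : {poly R}) := \sum_(i < size p) `|p`_i|.
have S0 p : 0 <= S p by apply: sumr_ge0.
exists (1 + \sum_(a < 5) \sum_(l < 5) S (stencil a l)).
  by rewrite ltr_pwDl// sumr_ge0// => a _; exact: sumr_ge0.
move=> a l t a4 l4 t01; apply: le_trans (horner_bound _ t01) _.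
apply: ler_wpDl => //; rewrite -ltnS in a4; rewrite -ltnS in l4.
rewrite (bigD1 (Ordinal a4))//= (bigD1 (Ordinal l4))//= -/(S _).
rewrite -addrA ler_wpDr// addr_ge0 ?sumr_ge0// => i _.
exact: sumr_ge0.
Qed.

End OneDim.

(** * Partial derivatives of the interpolant *)

Section SeparableFunctions.
Variables (R : realType) (d : nat).
Implicit Types (x y : 'rV[R]_d) (j : 'I_d) (phi : 'I_d -> R -> R).

(** Along the [j]th axis only the [j]th factor varies. *)
Lemma is_derive_prod_coord phi j x l :
  is_derive (x 0 j) 1 (phi j) l ->
  is_derive x (delta_mx 0 j) (fun y => \prod_i phi i (y 0 i))
    (l * \prod_(i | i != j) phi i (x 0 i)).
Proof.
move=> [dj dl]; set c := \prod_(i | _) _.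
suff qc : h^-1 *: ((\prod_i phi i ((h *: delta_mx 0 j + x) 0 i))
                    - \prod_i phi i (x 0 i)) @[h --> 0^'] --> l * c.
  by split; [apply/cvg_ex; exists (l * c) | apply/cvg_lim].
have -> : (fun h : R => h^-1 *: ((\prod_i phi i ((h *: delta_mx 0 j + x) 0 i))
                    - \prod_i phi i (x 0 i))) =
          (fun h : R => h^-1 *: (phi j (h *: 1 + x 0 j) - phi j (x 0 j)) * c).
  apply/funext => h; rewrite (bigD1 j)//= [X in _ - X](bigD1 j)//= -/c.
  rewrite -scalerAl mulrBl !mxE !eqxx/= -[h *: 1]/(h * 1).
  congr (_ *: (_ * _ - _)); apply: eq_bigr => i ij.
  by rewrite !mxE (negbTE ij) andbF mulr0 add0r.
by apply: cvgMr_tmp; rewrite -dl; exact: dj.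
Qed.

Lemma is_derive_lincomb (V : normedModType R) (I : finType) (c l : I -> R)
    (F : I -> V -> R) (x v : V) :
  (forall i, is_derive x v (F i) (l i)) ->
  is_derive x v (fun y : V => \sum_i c i * F i y) (\sum_i c i * l i).
Proof.
move=> dF; elim: (index_enum I) => [|i r IH].
  rewrite big_nil; have -> : (fun y : V => \sum_(i <- [::]) c i * F i y) = cst 0.
    by apply/funext => y; rewrite big_nil.
  exact: is_derive_cst.
rewrite big_cons; have -> : (fun y : V => \sum_(i0 <- i :: r) c i0 * F i0 y) =
   (c i *: F i) + (fun y : V => \sum_(i <- r) c i * F i y).
  by apply/funext => y; rewrite big_cons.
apply: is_deriveD.
Qed.

Lemma continuous_separable (I : finType) (c : I -> R) (phi : I -> 'I_d -> R -> R) x :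
  (forall i j, {for x 0 j, continuous (phi i j)}) ->
  {for x, continuous (fun y : 'rV[R]_d => \sum_i c i * \prod_j phi i j (y 0 j))}.
Proof.
move=> cphi; rewrite /prop_for /continuous_at.
apply: (@cvg_big _ _ _ _ _ (@add_continuous R) _ (nbhs x)) => i _.
apply: cvgMl_tmp; apply: (@cvg_big _ _ _ _ _ (@mul_continuous R) _ (nbhs x)) => j _.
by apply: (cvg_comp _ _ (@coord_continuous _ _ _ 0 j x)); exact: cphi.
Qed.

Lemma near_coord x j (P : R -> Prop) :
  (\forall t \near x 0 j, P t) -> \forall y \near x, P ((y : 'rV[R]_d) 0 j).
Proof. by move=> nP; exact: (@coord_continuous _ _ _ 0 j x _ nP). Qed.

Lemma near_forall_coord x (P : 'I_d -> 'rV[R]_d -> Prop) :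
  (forall j, \forall y \near x, P j y) -> \forall y \near x, forall j, P j y.
Proof. exact: (filter_forall (nbhs_filter x)). Qed.

End SeparableFunctions.

Section TensorProduct.
Variables (R : realType) (d : nat) (delta : R) (u : 'rV[int]_d -> R).
Hypothesis delta_gt0 : 0 < delta.
Implicit Types (x y : 'rV[R]_d) (a : 'I_d -> nat) (j : 'I_d).

(** The sum defining [Aop], for grid values [u], with the [a_j]th derivative
    of the weight in direction [j]; it is the candidate for the partial
    derivative of order [a]. *)
Definition Ader a x : R :=
  \sum_(i : {ffun 'I_d -> 'I_5})
    (\prod_j dalpha delta (a j) (cell delta x 0 j + (i j)%:Z) (x 0 j))
    * u (cell delta x + offset i).

Lemma sum_dalpha_kron n m (t : R) (k := Num.floor (t / delta)) :
  \sum_(i < 5) dalpha delta n (k + i%:Z) t * kron R m (k + i%:Z) = dalpha delta n m t.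
Proof.
have [[l ml]|ml] := pselect (exists l : 'I_5, m = k + l%:Z).
  rewrite (bigD1 l)//= ml /kron eqxx mulr1 big1 ?addr0// => i il.
  by rewrite (inj_eq (addrI k)) eqz_nat (inj_eq val_inj) (negbTE il) mulr0.
rewrite dalpha_support => [|l ml']; last by apply: ml; exists l.
rewrite big1// => i _; rewrite /kron; case: eqP => [e|_]; last by rewrite mulr0.
by case: ml; exists i.
Qed.

Definition box_sum (b : 'rV[int]_d) N a x : R :=
  \sum_(s : {ffun 'I_d -> 'I_N}) u (b + \row_j (s j)%:Z) *
     \prod_j dalpha delta (a j) (b 0 j + (s j)%:Z) (x 0 j).

(** On a region meeting several cells a single box of grid points serves all
    of them, as the weights vanish off the stencil of each cell. *)
Lemma Ader_box a x (b : 'rV[int]_d) N :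
  (forall j, b 0 j <= cell delta x 0 j /\ cell delta x 0 j + 5%:Z <= b 0 j + N%:Z) ->
  Ader a x = box_sum b N a x.
Proof.
move=> bx; rewrite /Ader /box_sum.
pose k j := Num.floor (x 0 j / delta).
pose F (s : {ffun 'I_d -> 'I_N}) j (i : 'I_5) :=
  dalpha delta (a j) (k j + i%:Z) (x 0 j) * kron R (b 0 j + (s j)%:Z) (k j + i%:Z).
transitivity (\sum_(i : {ffun 'I_d -> 'I_5}) \sum_(s : {ffun 'I_d -> 'I_N})
    u (b + \row_j (s j)%:Z) * \prod_j F s j (i j)).
  apply: eq_bigr => i _; rewrite (@box_expansion R d N b); last first.
    move=> j; have [] := bx j; rewrite !mxE; have := ltn_ord (i j).
    move: (Num.floor _) (b 0 j) (nat_of_ord _) => c z n; lia.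
  rewrite mulr_sumr; apply: eq_bigr => s _; rewrite mulrCA -big_split/=.
  by congr (_ * _); apply: eq_bigr => j _; rewrite !mxE.
rewrite exchange_big/=; apply: eq_bigr => s _; rewrite -mulr_sumr.
rewrite -(bigA_distr_bigA (F s)); congr (_ * _).
by apply: eq_bigr => j _; rewrite sum_dalpha_kron.
Qed.

(** Each coordinate stays in its cell or enters the preceding one, so 6 grid
    indices per direction suffice, starting one below the cell. *)
Lemma Ader_near x : exists b : 'rV[int]_d,
  \forall y \near x, forall a, Ader a y = box_sum b 6 a y.
Proof.
exists (\row_j (cell delta x 0 j - 1)).
have nx : \forall y \near x, forall j,
    cell delta x 0 j - 1 <= cell delta y 0 j <= cell delta x 0 j.
  apply: near_forall_coord => j; rewrite mxE.
  have [k' k'E nk] := near_cell (x 0 j) delta_gt0.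
  have := near_coord nk; apply: filterS => y; rewrite mxE.
  case: k'E => [->|[_ kE]] [->|->]; rewrite ?kE; lia.
apply: filterS nx => y yx a; apply: Ader_box => j; rewrite (mxE _ _ 0 j).
have := yx j; set c := cell _ _ _ _; set c' := cell _ _ _ _; lia.
Qed.

Definition smooth_at_order a x := forall j, smooth_order delta (a j) (x 0 j).

Definition incr a j n : 'I_d -> nat := fun i => (a i + (i == j) * n)%N.

Lemma smooth_at_order_le a a' x : (forall j, a j <= a' j)%N ->
  smooth_at_order a' x -> smooth_at_order a x.
Proof.
move=> aa' ga' j; case: (ga' j) => [a'3|]; [left|by right].
exact: leq_trans (aa' j) a'3.
Qed.

Lemma smooth_at_order_incr a j n x :
  smooth_at_order (incr a j n) x -> smooth_at_order a x.
Proof. by apply: smooth_at_order_le => i; rewrite leq_addr. Qed.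

Lemma near_smooth_at_order a x :
  smooth_at_order a x -> \forall y \near x, smooth_at_order a y.
Proof.
move=> gx; apply: near_forall_coord => j; case: (gx j) => [a3|ox].
  by apply: (@filterE _ (nbhs x)) => y; left.
have := near_coord (offgrid_near delta_gt0 ox).
by apply: filterS => y oy; right.
Qed.

Lemma continuous_Ader a x : smooth_at_order a x -> {for x, continuous (Ader a)}.
Proof.
move=> gx; have [b nb] := Ader_near x.
have nb' : \forall y \near x, box_sum b 6 a y = Ader a y.
  by apply: filterS nb => y ->.
rewrite /prop_for /continuous_at (nbhs_singleton nb).
apply: cvg_trans (near_eq_cvg nb') _.
apply: (@continuous_separable _ _ _ _
  (fun (s : {ffun 'I_d -> 'I_6}) j => dalpha delta (a j) (b 0 j + (s j)%:Z))).
by move=> s j; exact: continuous_dalpha.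
Qed.

Lemma is_derive_Ader a j x : smooth_at_order (incr a j 1) x ->
  is_derive x (delta_mx 0 j) (Ader a) (Ader (incr a j 1) x).
Proof.
move=> gx; have [b nb] := Ader_near x.
have nb' : \forall y \near x, box_sum b 6 a y = Ader a y.
  by apply: filterS nb => y ->.
apply: (near_eq_is_derive nb'); rewrite (nbhs_singleton nb).
apply: is_derive_lincomb => s; rewrite [X in is_derive _ _ _ X](bigD1 j)//=.
rewrite (eq_bigr (fun i => dalpha delta (a i) (b 0 i + (s i)%:Z) (x 0 i))); last first.
  by move=> i /negbTE ij; rewrite /incr ij addn0.
apply: (@is_derive_prod_coord _ _ (fun i => dalpha delta (a i) (b 0 i + (s i)%:Z))).
by rewrite /incr eqxx mul1n addn1; apply: is_derive_dalpha => //;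
  have := gx j; rewrite /incr eqxx mul1n addn1.
Qed.

(** Derivatives only see a neighbourhood, so it is enough to know [g] at the
    points of smoothness, which form an open set by [near_smooth_at_order]. *)
Lemma iter_partial_Ader a j n (g : 'rV[R]_d -> R) :
  (forall x, smooth_at_order a x -> g x = Ader a x) ->
  forall x, smooth_at_order (incr a j n) x ->
    iter n (partial j) g x = Ader (incr a j n) x.
Proof.
move=> gE; elim: n => [|n IH] x gx /=.
  have e : incr a j 0 = a by apply/funext => i; rewrite /incr muln0 addn0.
  by rewrite e in gx *; exact: gE.
have e : incr a j n.+1 = incr (incr a j n) j 1.
  by apply/funext => i; rewrite /incr -addnA -mulnDr addn1.
rewrite e in gx *; rewrite /partial.
have nE : \forall y \near x, iter n (partial j) g y = Ader (incr a j n) y.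
  by have := near_smooth_at_order (smooth_at_order_incr gx);
    apply: filterS => y; exact: IH.
by rewrite (near_eq_derive _ nE); have [_ ->] := is_derive_Ader gx.
Qed.

Lemma mpartial_Ader a (g : 'rV[R]_d -> R) :
  (forall x, g x = Ader (fun=> 0%N) x) ->
  forall x, smooth_at_order a x -> mpartial a g x = Ader a x.
Proof.
move=> gE.
suff H r : uniq r -> forall x,
    smooth_at_order (fun j => if j \in r then a j else 0%N) x ->
    foldr (fun j => iter (a j) (partial j)) g r x =
    Ader (fun j => if j \in r then a j else 0%N) x.
  have e : a = fun j => if j \in enum 'I_d then a j else 0%N.
    by apply/funext => j; rewrite mem_enum.
  by move=> x; rewrite /mpartial [X in smooth_at_order X]e [X in Ader X]e;
    apply: H; exact: enum_uniq.
elim: r => [_ x _|j r IH /= /andP[jr ur] x]; first exact: gE.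
have -> : (fun i => if i \in j :: r then a i else 0%N) =
          incr (fun i => if i \in r then a i else 0%N) j (a j).
  apply/funext => i; rewrite /incr in_cons; case: eqP => [->|_].
    by rewrite (negbTE jr) mul1n.
  by rewrite addn0.
by apply: iter_partial_Ader; exact: IH.
Qed.

Lemma mnorm1_incr a j n : mnorm1 (incr a j n) = (mnorm1 a + n)%N.
Proof.
rewrite /mnorm1 big_split/=; congr (_ + _)%N.
by rewrite (bigD1 j)//= eqxx mul1n big1 ?addn0// => i /negbTE ->.
Qed.

(** Serves both global regularity of order 3 ([U] the whole space) and
    smoothness off the grid hyperplanes. *)
Lemma Cn_open_Ader n (U : set 'rV[R]_d) a g : open U ->
  (forall b, (mnorm1 b <= mnorm1 a + n)%N -> forall x, U x -> smooth_at_order b x) ->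
  (forall x, U x -> g x = Ader a x) -> Cn_open n U g.
Proof.
move=> oU; elim: n a g => [|n IH] a g gU gE.
all: have gN x : U x -> \forall y \near x, Ader a y = g y by
  move=> Ux; apply: filterS (open_nbhs_nbhs (conj oU Ux)) => y /gE.
all: have cg x : U x -> {for x, continuous g} by
  move=> Ux; rewrite /prop_for /continuous_at gE//;
  apply: cvg_trans (near_eq_cvg (gN x Ux)) _;
  apply: continuous_Ader; apply: gU; rewrite ?leq_addr.
  by split.
split=> // j.
have dg x : U x -> is_derive x (delta_mx 0 j) g (Ader (incr a j 1) x).
  move=> Ux; apply: near_eq_is_derive (gN x Ux) _; apply: is_derive_Ader.
  by apply: gU => //; rewrite mnorm1_incr addn1 addnS ltnS leq_addr.
split=> [x /dg[]//|]; apply: (IH (incr a j 1)) => [b ba x Ux|x /dg[_]//].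
by apply: gU => //; rewrite mnorm1_incr addn1 addSnnS in ba.
Qed.

End TensorProduct.

(** * Estimate by finite differences, null sets and interpolation *)

Section Bound.
Variables (R : realType) (d : nat) (delta : R).
Hypothesis delta_gt0 : 0 < delta.
Implicit Types (x y : 'rV[R]_d) (a : 'I_d -> nat) (j : 'I_d).
Implicit Types (u : 'rV[int]_d -> R) (f : 'rV[R]_d -> R).

Definition cell_coord x j : R := (x 0 j - delta * (cell delta x 0 j)%:~R) / delta.

Lemma mfdiff_box a u (k : 'rV[int]_d) (l : {ffun 'I_d -> 'I_5}) :
  (forall j, l j + a j <= 4)%N ->
  mfdiff a u (k + offset l) =
  \sum_(i : {ffun 'I_d -> 'I_5}) u (k + offset i) *
    \prod_j iter (a j) (@fdiff1 R) (kron R (k 0 j + (i j)%:Z)) (k 0 j + (l j)%:Z).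
Proof.
move=> la.
transitivity (mfdiff a (fun z => \sum_(i : {ffun 'I_d -> 'I_5}) u (k + offset i) *
    tprod (fun j => kron R (k 0 j + (i j)%:Z)) z) (k + offset l)).
  apply: mfdiff_local => s sa; apply: box_expansion => j; rewrite !mxE.
  have := sa j; have := la j; move: (k 0 j) (nat_of_ord (l j)) (s j) (a j).
  by move=> *; lia.
rewrite mfdiff_sum; apply: eq_bigr => i _; rewrite mfdiff_tprod /tprod.
by congr (_ * _); apply: eq_bigr => j _; rewrite !mxE.
Qed.

(** By [mfdiff_box] both sides are combinations of the values of [u] on the
    stencil; the coefficients are products over the coordinates, whose factors
    agree by [dalpha_stencil]. *)
Lemma Ader_stencil a u x : (forall j, a j <= 4)%N ->
  Ader delta u a x = delta ^- mnorm1 a *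
    \sum_(l : {ffun 'I_d -> 'I_5}) (\prod_j (stencil R (a j) (l j)).[cell_coord x j])
      * mfdiff a u (cell delta x + offset l).
Proof.
move=> a4; set k := cell delta x.
pose F (i l : {ffun 'I_d -> 'I_5}) j :=
  iter (a j) (@fdiff1 R) (kron R (k 0 j + (i j)%:Z)) (k 0 j + (l j)%:Z).
pose st (l : {ffun 'I_d -> 'I_5}) j := (stencil R (a j) (l j)).[cell_coord x j].
have mE (l : {ffun 'I_d -> 'I_5}) :
    (\prod_j st l j) * mfdiff a u (k + offset l) =
    \sum_(i : {ffun 'I_d -> 'I_5}) u (k + offset i) * \prod_j (st l j * F i l j).
  have [la|/existsP[j]] := boolP [forall j, (l j + a j <= 4)%N].
    rewrite (mfdiff_box _ _ (forallP la)) mulr_sumr; apply: eq_bigr => i _.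
    by rewrite mulrCA -big_split.
  (* Outside this range [mfdiff] would leave the stencil, but the weight is
     zero. *)
  rewrite -ltnNge addnC => /(stencil_eq0 R) s0.
  rewrite (bigD1 j)//= {1}/st s0 horner0 !mul0r big1// => i _.
  by rewrite (bigD1 j)//= {1}/st s0 horner0 !mul0r mulr0.
under eq_bigr do rewrite mE.
rewrite exchange_big/= mulr_sumr; apply: eq_bigr => i _.
rewrite -mulr_sumr mulrCA mulrC; congr (_ * _).
rewrite -(bigA_distr_bigA (fun j (l : 'I_5) => (stencil R (a j) l).[cell_coord x j] *
  iter (a j) (@fdiff1 R) (kron R (k 0 j + (i j)%:Z)) (k 0 j + l%:Z))).
rewrite /mnorm1 -prodrXr -prodfV -big_split/=; apply: eq_bigr => j _.
by rewrite dalpha_stencil// /cell_coord mxE.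
Qed.

Lemma Aop_Ader f x : Aop delta f x = Ader delta (f \o lat delta) (fun=> 0%N) x.
Proof.
apply: eq_bigr => i _; congr (_ * _); apply: eq_bigr => j _.
by rewrite dalpha0 mxE.
Qed.

Lemma Ader_bound a u x M : 0 < M ->
  (forall n l t, (n <= 4)%N -> (l <= 4)%N -> 0 <= t <= 1 ->
     `|(stencil R n l).[t]| <= M) ->
  (forall j, a j <= 4)%N ->
  `|Ader delta u a x| <= #|{ffun 'I_d -> 'I_5}|%:R * M ^+ d * delta ^- mnorm1 a *
    \big[Num.max/0]_(i : {ffun 'I_d -> 'I_5} | [forall j, (i j <= 4 - a j)%N])
       `|mfdiff a u (cell delta x + offset i)|.
Proof.
move=> M0 bM a4; rewrite Ader_stencil//; set m := \big[Num.max/0]_(_ | _) _.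
have m0 : 0 <= m by exact: bigmax_ge_id.
have dn0 : 0 < delta ^- mnorm1 a by rewrite invr_gt0 exprn_gt0.
rewrite normrM (gtr0_norm dn0) -mulrA mulrCA ler_pM2l// (le_trans (ler_norm_sum _ _ _))//.
have -> : #|{ffun 'I_d -> 'I_5}|%:R * M ^+ d * m =
    \sum_(l : {ffun 'I_d -> 'I_5}) M ^+ d * m.
  by rewrite sumr_const -mulrA mulr_natl.
apply: ler_sum => l _; rewrite normrM.
have [la|/existsP[j]] := boolP [forall j, (l j <= 4 - a j)%N]; last first.
  rewrite -ltnNge => la; rewrite (bigD1 j)//= stencil_eq0; last first.
    by move: (a j) (nat_of_ord (l j)) la => p q; lia.
  by rewrite horner0 mul0r normr0 mul0r mulr_ge0// exprn_ge0// ltW.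
apply: ler_pM => //; last exact: (le_bigmax_cond _ (fun i => `|mfdiff a u _|)).
rewrite normr_prod -[leRHS](_ : \prod_(j < d) M = _); last first.
  by rewrite prodr_const card_ord.
apply: ler_prod => j _; rewrite normr_ge0/=; apply: bM => //.
- by rewrite -ltnS ltn_ord.
- by rewrite /cell_coord mxE cell_coord_itv.
Qed.

End Bound.

Section NullSet.
Variables (R : realType) (d : nat).
Hypothesis d_gt0 : (0 < d)%N.
Implicit Types (x : 'rV[R]_d) (B : set 'rV[R]_d).

Lemma box_vol_ge0 (b : 'rV[R]_d * 'rV[R]_d) : 0 <= box_vol b.
Proof. by apply: prodr_ge0 => j _; rewrite le_max lexx. Qed.

Lemma lebesgue_outer_null B (b : nat -> 'rV[R]_d * 'rV[R]_d) :
  (forall n, box_vol (b n) = 0) -> B `<=` \bigcup_n box (b n) ->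
  lebesgue_outer B = 0%E.
Proof.
move=> b0 Bb; apply/eqP; rewrite eq_le; apply/andP; split.
  apply: ereal_inf_lbound; exists b => //=.
  by apply: eseries0 => n _ _; rewrite b0.
apply: le_ereal_inf_tmp => _ [c _ <-]; apply: nneseries_ge0 => n _ _.
by rewrite lee_fin box_vol_ge0.
Qed.

(** Each hyperplane of the lattice is exhausted by countably many flat boxes. *)
Lemma ae_on_offgrid B (delta : R) (P : 'rV[R]_d -> Prop) :
  (forall x, (forall j, offgrid delta (x 0 j)) -> P x) -> ae_on B P.
Proof.
move=> offP; pose slab (w : 'I_d * int * nat) : 'rV[R]_d * 'rV[R]_d :=
  let c := delta * w.1.2%:~R in
  (\row_j (if j == w.1.1 then c else - w.2%:R),
   \row_j (if j == w.1.1 then c else w.2%:R)).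
pose b n := if unpickle n is Some w then slab w else (0, 0).
apply: (@lebesgue_outer_null _ b).
  move=> n; rewrite /b; case: (unpickle n) => [[[j k] N]|].
    by rewrite /box_vol (bigD1 j)//= !mxE !eqxx subrr maxxx mul0r.
  (* The default box has volume zero only because there is a coordinate. *)
  by rewrite /box_vol (bigD1 (Ordinal d_gt0))//= !mxE subrr maxxx mul0r.
move=> x [_ nPx]; have [j [k xjk]] : exists j k, x 0 j = delta * k%:~R.
  apply: contrapT => nx; apply/nPx/offP => j k xjk; apply: nx; by exists j, k.
have [N xN] : exists N : nat, forall j, `|x 0 j| <= N%:R.
  exists (\max_i Num.truncn `|x 0%R i|)%N.+1 => i.
  apply: le_trans (ltW (truncnS_gt _)) _; rewrite ler_nat ltnS.
  exact: (@leq_bigmax _ (fun i => Num.truncn `|x 0%R i|)).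
exists (pickle (j, k, N)) => //; rewrite /b pickleK /slab/= => i; rewrite !mxE/=.
by case: eqP => [->|_]; [rewrite xjk lexx | rewrite -ler_norml].
Qed.

End NullSet.

Section Interpolation.
Variables (R : realType) (d : nat).
Implicit Types (delta : R) (k : 'rV[int]_d) (f : 'rV[R]_d -> R).

Lemma interp1_grid delta (k : int) g : interp1 delta k g (delta * k%:~R) = g k.
Proof. by rewrite /interp1 subrr mul0r !expr0n/=; ring. Qed.

Lemma cell_lat delta k : 0 < delta -> cell delta (lat delta k) = k.
Proof.
move=> d0; apply/rowP => j; rewrite !mxE mulrAC divff ?gt_eqF// mul1r.
exact: intrKfloor.
Qed.

Lemma Aop_lat delta f k : 0 < delta -> Aop delta f (lat delta k) = f (lat delta k).
Proof.
move=> d0; rewrite /Aop cell_lat// [RHS](@box_expansion R d 5 k k (f \o lat delta)).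
  apply: eq_bigr => i _; rewrite mulrC; congr (_ * _); apply: eq_bigr => j _.
  by rewrite /alpha !mxE interp1_grid.
by move=> j; rewrite lexx/= ltrDl.
Qed.

End Interpolation.

Theorem theorem3 (R : realType) (d : nat) (d_ge1 : (1 <= d)%N) :
  exists C : R, 0 < C /\
  forall (delta : R) (K : set 'rV[R]_d) (f : 'rV[R]_d -> R),
    0 < delta ->
    convex_set (K : set (convex_lmodType 'rV[R]_d)) ->
    [/\ Cn 3 (conv_hull (K4 delta K)) (Aop delta f),
        ae_on (conv_hull (K4 delta K)) (smooth_at (Aop delta f)),
        forall k : 'rV[int]_d, K4 delta K (lat delta k) ->
          Aop delta f (lat delta k) = f (lat delta k),
        forall a : 'I_d -> nat, (mnorm1 a <= 3)%N ->
          forall x, conv_hull (K4 delta K) x ->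
            derivative_bound C delta f a x
      & forall a : 'I_d -> nat, mnorm1 a = 4%N ->
          ae_on (conv_hull (K4 delta K)) (derivative_bound C delta f a)].
Proof.
have [M M0 bM] := stencil_bounded R.
exists (#|{ffun 'I_d -> 'I_5}|%:R * M ^+ d); split.
  by rewrite mulr_gt0 ?exprn_gt0// ltr0n card_ffun !card_ord expn_gt0.
move=> delta K f d0 _.
have a_le (a : 'I_d -> nat) j : (a j <= mnorm1 a)%N.
  by rewrite /mnorm1 (bigD1 j)//= leq_addr.
have bound a x : (mnorm1 a <= 4)%N -> smooth_at_order delta a x ->
    derivative_bound (#|{ffun 'I_d -> 'I_5}|%:R * M ^+ d) delta f a x.
  move=> a4 gx; rewrite /derivative_bound.
  rewrite (mpartial_Ader d0 (u := f \o lat delta) (Aop_Ader _ _) gx).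
  by apply: Ader_bound => // j; exact: leq_trans (a_le a j) a4.
have offgrid_smooth (a : 'I_d -> nat) (x : 'rV[R]_d) :
    (forall j, offgrid delta (x 0 j)) -> smooth_at_order delta a x.
  by move=> ox j; right.
split.
- exists setT; split; [exact: openT|exact: subsetT|].
  apply: (Cn_open_Ader d0 (u := f \o lat delta) (a := fun=> 0%N)) => [|b b3 x _ j|x _].
  + exact: openT.
  + by left; rewrite (leq_trans (a_le b j))// (leq_trans b3)// /mnorm1 big1.
  + exact: Aop_Ader.
- apply: (@ae_on_offgrid R d d_ge1 _ delta) => x ox.
  pose U := (fun y : 'rV[R]_d => forall j, offgrid delta (y 0 j)).
  exists (U^°%classic); split.
  + exact: open_interior.
  + apply: (near_forall_coord (P := fun j y => offgrid delta (y 0 j))) => j.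
    exact: near_coord (offgrid_near d0 (ox j)).
  + move=> n; apply: (Cn_open_Ader d0 (u := f \o lat delta) (a := fun=> 0%N)).
    * exact: open_interior.
    * by move=> b _ y /interior_subset Uy; exact: offgrid_smooth.
    * by move=> y _; exact: Aop_Ader.
- by move=> k _; exact: Aop_lat.
- move=> a a3 x _; apply: bound; first exact: leq_trans a3 _.
  by move=> j; left; exact: leq_trans (a_le a j) a3.
- move=> a a4; apply: (@ae_on_offgrid R d d_ge1 _ delta) => x ox.
  by apply: bound; [rewrite a4|exact: offgrid_smooth ox].
Qed.
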